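(* Let $R$ be a left Zacharias domain, $\mathsf R$ a multivariate Ore extension of $R$ in which each $\alpha_i$ is an automorphism of $R$, and $F=\{g_1,\dots,g_u\}\subset\mathsf R^m\setminus\{0\}$ with $\mathbf M(g_i)=c_i\tau_i\mathbf e_{l_i}$. For $1\le s\le u$ let $\mathcal S_s=\{(h_1,\dots,h_s)\in\mathsf S^s:\sum_{i=1}^sh_i\ast\mathbf M(g_i)=0\}$, and regard $\mathcal S_{s-1}$ as a subset of $\mathcal S_s$ by appending a zero coordinate. Let $2\le s\le u$ and denote by - $\{A_1,\dots,A_\mu\}$ a $\mathcal T^{(m)}$-homogeneous basis (generating set) of $\mathcal S_{s-1}$; - $\mathcal H$ the set of all basic subsets $H\subset\{1,\dots,s\}$; - for each $H\in\mathcal H$, $\{d_{1H},\dots,d_{r_HH}\}$ a basis (generating set) of the left ideal $\mathbb I_L(\{\alpha_{H,i}(c_i):i\in H\setminus\{s\}\}):\mathbb I_L(\alpha_{H,s}(c_s))$; - for each $H\in\mathcal H$ and $1\le j\le r_H$, $D_{jH}$ a syzygy associated to $H$ and $d_{jH}$. Then $\{A_1,\dots,A_\mu\}\cup\{D_{jH}:H\in\mathcal H,\ 1\le j\le r_H\}$ is a $\mathcal T^{(m)}$-homogeneous basis (generating set) of the left $\mathsf S$-module $\mathcal S_s$.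
   Context: **Ore extensions.** $R$ is a (not necessarily commutative) domain with identity. A multivariate Ore extension $\mathsf R=R[Y_1;\alpha_1,\delta_1]\cdots[Y_n;\alpha_n,\delta_n]$ is an iterated Ore extension ($Y_i\star r=\alpha_i(r)Y_i+\delta_i(r)$, $\alpha_i$ an injective ring endomorphism mapping $R$ to $R$, $\delta_i$ an $\alpha_i$-derivation mapping $R$ to $R$) such that $\alpha_j\delta_i=\delta_i\alpha_j$ for $i\ne j$, $\alpha_i\alpha_j=\alpha_j\alpha_i$, $\delta_i\delta_j=\delta_j\delta_i$, and $\alpha_j(Y_i)=Y_i$, $\delta_j(Y_i)=0$ for $i<j$. It is a free left $R$-module on the set of terms $\mathcal T=\{Y_1^{a_1}\cdots Y_n^{a_n}\}$, a commutative monoid. For $\tau=Y_1^{a_1}\cdots Y_n^{a_n}$ put $\alpha_\tau=\alpha_1^{a_1}\cdots\alpha_n^{a_n}:R\to R$. The associated graded Ore extension $\mathsf S=R[Y_1;\alpha_1]\cdots[Y_n;\alpha_n]$ is the same left $R$-module with multiplication $\ast$ determined by $(a\tau)\ast(b\omega)=a\,\alpha_\tau(b)\,\tau\omega$. **Terms.** $\mathsf R^m$ has canonical basis $\mathbf e_1,\dots,\mathbf e_m$ and terms $\mathcal T^{(m)}=\{t\mathbf e_i\}$; a term ordering on $\mathcal T^{(m)}$ compatible with one on $\mathcal T$ is fixed and $\mathbf M(f)$ is the maximal monomial (leading coefficient times maximal term) of $f\ne0$. An element $\sum_ia_i\lambda_ie_i$ of $\mathsf S^s$ ($a_i\in R$,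 $\lambda_i\in\mathcal T$, $e_i$ canonical basis) is $\mathcal T^{(m)}$-homogeneous if $\lambda_i\tau_i\mathbf e_{l_i}$ is the same term for all $i$ with $a_i\ne0$. **Basic subsets.** Consider nonempty subsets $H\subset\{1,\dots,s\}$ such that $l_i$ is constant for $i\in H$; let $\varepsilon_H=\mathbf e_{l_i}$ ($i\in H$), $\tau_H=\mathrm{lcm}(\tau_i:i\in H)$, $\mathbf T(H)=\tau_H\varepsilon_H$, and $\alpha_{H,i}=\alpha_{\tau_H/\tau_i}$ for $i\in H$. $H$ is maximal for a term $\delta\epsilon$ if $H=\{i:1\le i\le s,\ \tau_i\mid\delta,\ \mathbf e_{l_i}=\epsilon\}$; $H$ is basic if $s\in H$ and $H$ is maximal for $\mathbf T(H)$. **Colon ideals and associated syzygies.** For a left ideal $\mathfrak a\subset R$ and $c\in R$, $\mathfrak a:\mathbb I_L(c)$ means $\{d\in R:dc\in\mathfrak a\}$, where $\mathbb I_L(\cdot)$ denotes generated left ideal. For basic $H$ and $d_s\in\mathbb I_L(\{\alpha_{H,i}(c_i):i\in H\setminus\{s\}\}):\mathbb I_L(\alpha_{H,s}(c_s))$, a syzygy associated to $H$ and $d_s$ is any element $\sum_{i\in H\setminus\{s\}}d_i\frac{\tau_H}{\tau_i}e_i+d_s\frac{\tau_H}{\tau_s}e_s$ with $d_i\in R$ such that $d_s\alpha_{H,s}(c_s)=-\sum_{i\in H\setminus\{s\}}d_i\alpha_{H,i}(c_i)$. **Zacharias ring.** A ring $R$ with identity is a left Zacharias ring if (a) it is noetherian;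 (b) there is an algorithm which, given $c\in R^m$ and a finite $C=\{c_1,\dots,c_t\}\subset R^m\setminus\{0\}$, decides whether $c$ lies in the left module generated by $C$ and, if so, produces $d_i\in R$ with $c=\sum d_ic_i$; (c) there is an algorithm which, given $\{c_1,\dots,c_t\}\subset R^m\setminus\{0\}$, computes a finite set of generators of the left syzygy module $\{(d_1,\dots,d_t)\in R^t:\sum d_ic_i=0\}$. *)

(* Defs.v *)
From HB Require Import structures.
From mathcomp Require Import all_boot all_order all_algebra.
From mathcomp.multinomials Require Import mpoly.

Set Implicit Arguments.
Unset Strict Implicit.
Unset Printing Implicit Defensive.

Import GRing.Theory.
Local Open Scope ring_scope.

Definition ring_domain (R : nzRingType) : Prop :=
  forall x y : R, x * y = 0 -> x = 0 \/ y = 0.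

(* The left submodule generated by a set X of vectors. *)
Definition lspan (A : nzRingType) (V : lmodType A) (X : V -> Prop) (v : V)
    : Prop :=
  exists (k : nat) (a : 'I_k -> A) (x : 'I_k -> V),
    (forall i, X (x i)) /\ v = \sum_(i < k) a i *: x i.

(* X is a basis of the left submodule N in the weak sense of a generating
   set: no linear independence is required. *)
Definition lgenerates (A : nzRingType) (V : lmodType A) (X N : V -> Prop)
    : Prop :=
  forall v, N v <-> lspan X v.

Definition left_ideal_gen (R : nzRingType) (X : R -> Prop) : R -> Prop :=
  lspan (X : R^o -> Prop).

Definition is_left_ideal (R : nzRingType) (I : R -> Prop) : Prop :=
  [/\ I 0, forall x y, I x -> I y -> I (x + y) & forall a x, I x -> I (a * x)].

Definition left_noetherian (R : nzRingType) : Prop :=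
  forall I : R -> Prop, is_left_ideal I ->
    exists s : seq R, forall x, I x <-> left_ideal_gen (fun y => y \in s) x.

(* The algorithms are part of the structure, as functions on finite data.
   zach_mem C c returns the coefficients of a representation of c by C, or
   None if there is none; zach_syz C lists generators of the syzygies of C. *)
Record left_zacharias (R : nzRingType) : Type := LeftZacharias {
  zach_noetherian : left_noetherian R;
  zach_mem : forall m t : nat,
    t.-tuple 'rV[R]_m -> 'rV[R]_m -> option (t.-tuple R);
  zach_syz : forall m t : nat, t.-tuple 'rV[R]_m -> seq 'rV[R]_t;
  zach_memP : forall (m t : nat) (C : t.-tuple 'rV[R]_m) (c : 'rV[R]_m),
    (forall i, tnth C i != 0) ->
    match zach_mem C c with
    | Some d => c = \sum_(i < t) tnth d i *: tnth C i
    | None => ~ lspan (fun x => x \in C) c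
    end;
  zach_syzP : forall (m t : nat) (C : t.-tuple 'rV[R]_m),
    (forall i, tnth C i != 0) ->
    lgenerates (fun d => d \in zach_syz C)
      (fun d : 'rV[R]_t => \sum_(i < t) d 0 i *: tnth C i = 0) }.

Inductive subring_gen (E : nzRingType) (G : E -> Prop) : E -> Prop :=
| SubringGen x of G x : subring_gen G x
| Subring1 : subring_gen G 1
| SubringB x y of subring_gen G x & subring_gen G y : subring_gen G (x - y)
| SubringM x y of subring_gen G x & subring_gen G y : subring_gen G (x * y).

(* Inside the ring E, Q is the Ore extension P[y; a, d] of the subring P; the
   maps a and d only matter on P. Note that p.[y] = \sum_k p`_k * y ^+ k has
   its coefficients on the left. *)
Record is_ore_step (E : nzRingType) (P Q : E -> Prop) (a d : E -> E) (y : E)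
    : Prop := IsOreStep {
  ore_step_aP : forall x, P x -> P (a x);
  ore_step_a1 : a 1 = 1;
  ore_step_aB : forall x z, P x -> P z -> a (x - z) = a x - a z;
  ore_step_aM : forall x z, P x -> P z -> a (x * z) = a x * a z;
  ore_step_aI : forall x z, P x -> P z -> a x = a z -> x = z;
  ore_step_dP : forall x, P x -> P (d x);
  ore_step_dB : forall x z, P x -> P z -> d (x - z) = d x - d z;
  ore_step_dM : forall x z, P x -> P z -> d (x * z) = a x * d z + d x * z;
  ore_step_comm : forall x, P x -> y * x = a x * y + d x;
  ore_step_gen : forall x,
    Q x <-> exists p : {poly E}, (forall k, P p`_k) /\ x = p.[y];
  ore_step_free : forall p q : {poly E},
    (forall k, P p`_k) -> (forall k, P q`_k) -> p.[y] = q.[y] -> p = q }.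

(* For iota : R -> E and Y : 'I_n -> E, the subring R[Y_0, ..., Y_(k-1)]. *)
Definition ore_level (R E : nzRingType) (n : nat) (iota : R -> E)
    (Y : 'I_n -> E) (k : nat) : E -> Prop :=
  subring_gen (fun x => (exists r, x = iota r) \/
                        (exists2 i : 'I_n, (i < k)%N & x = Y i)).

(* E is a multivariate Ore extension R[Y_0; alpha_0, delta_0]...[Y_(n-1); ..],
   the intermediate rings being viewed as subrings of E. The maps oreA i and
   oreD i are alpha_i and delta_i on R[Y_0, ..., Y_(i-1)], while ore_alpha i
   and ore_delta i are their restrictions to R. *)
Record ore_ext (R E : nzRingType) (n : nat) : Type := OreExt {
  oreC : {rmorphism R -> E};
  oreY : 'I_n -> E;
  oreA : 'I_n -> E -> E;
  oreD : 'I_n -> E -> E;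
  ore_alpha : 'I_n -> {rmorphism R -> R};
  ore_delta : 'I_n -> R -> R;
  oreC_inj : injective oreC;
  ore_stepP : forall i : 'I_n,
    is_ore_step (ore_level oreC oreY i) (ore_level oreC oreY i.+1)
      (oreA i) (oreD i) (oreY i);
  ore_levelT : forall x : E, ore_level oreC oreY n x;
  oreA_C : forall i r, oreA i (oreC r) = oreC (ore_alpha i r);
  oreD_C : forall i r, oreD i (oreC r) = oreC (ore_delta i r);
  oreA_Y : forall i j : 'I_n, (i < j)%N -> oreA j (oreY i) = oreY i;
  oreD_Y : forall i j : 'I_n, (i < j)%N -> oreD j (oreY i) = 0;
  ore_alpha_delta : forall i j r, i != j ->
    ore_alpha j (ore_delta i r) = ore_delta i (ore_alpha j r);
  ore_alphaC : forall i j r,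
    ore_alpha i (ore_alpha j r) = ore_alpha j (ore_alpha i r);
  ore_deltaC : forall i j r,
    ore_delta i (ore_delta j r) = ore_delta j (ore_delta i r) }.

(* The power products of the variables are the monomials 'X_{1..n}. *)
Definition ore_alphaT (R E : nzRingType) (n : nat) (X : ore_ext R E n)
    (t : 'X_{1..n}) : R -> R :=
  \big[comp/idfun]_(i < n) iter (t i) (ore_alpha X i).

(* The graded Ore extension associated to X: the free left R-module on
   'X_{1..n}, as given by {mpoly R[n]}, with a twisted multiplication gr_mul
   which becomes its ring structure below. *)
Definition ore_gr (R E : nzRingType) (n : nat) (X : ore_ext R E n) : Type :=
  {mpoly R[n]}.

Definition gr_mon (R E : nzRingType) (n : nat) (X : ore_ext R E n)
    (a : R) (t : 'X_{1..n}) : ore_gr X :=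
  (a *: 'X_[t] : {mpoly R[n]}).

Definition gr_coef (R E : nzRingType) (n : nat) (X : ore_ext R E n)
    (f : ore_gr X) (t : 'X_{1..n}) : R :=
  mcoeff t (f : {mpoly R[n]}).

Definition gr_supp (R E : nzRingType) (n : nat) (X : ore_ext R E n)
    (f : ore_gr X) : seq 'X_{1..n} := msupp (f : {mpoly R[n]}).

HB.instance Definition _ (R E : nzRingType) (n : nat) (X : ore_ext R E n) :=
  GRing.Lmodule.on (ore_gr X).

Definition gr_mul (R E : nzRingType) (n : nat) (X : ore_ext R E n)
    (f g : ore_gr X) : ore_gr X :=
  \sum_(t <- gr_supp f) \sum_(w <- gr_supp g)
    gr_mon X (gr_coef f t * ore_alphaT X t (gr_coef g w)) (t + w)%MM.

Section GradedRing.
Variables (R E : nzRingType) (n : nat) (X : ore_ext R E n).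
Implicit Types (f g h : ore_gr X) (t w : 'X_{1..n}) (a b : R).
Local Notation al := (ore_alphaT X).

Lemma alphaT_rec (P : (R -> R) -> Prop) t :
  P idfun -> (forall i (F : R -> R), P F -> P (ore_alpha X i \o F)) -> P (al t).
Proof.
move=> P0 PS; rewrite /ore_alphaT; elim/big_rec: _ => // i f _ Pf.
elim: (t i) => [|k IHk]; first exact: Pf.
exact: (PS i (iter k (ore_alpha X i) \o f)).
Qed.

Lemma alphaTB t : {morph al t : a b / a - b}.
Proof.
apply: (@alphaT_rec (fun F => {morph F : a b / a - b})) => // i f Hf a b.
by rewrite /= Hf rmorphB.
Qed.

Lemma alphaTM t : {morph al t : a b / a * b}.
Proof.
apply: (@alphaT_rec (fun F => {morph F : a b / a * b})) => // i f Hf a b.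
by rewrite /= Hf rmorphM.
Qed.

Lemma alphaT1 t : al t 1 = 1.
Proof.
by apply: (@alphaT_rec (fun F => F 1 = 1)) => // i f /= ->; rewrite rmorph1.
Qed.

Lemma alphaT_0 t : al t 0 = 0.
Proof. by have := alphaTB t 0 0; rewrite !subrr. Qed.

Lemma alphaTD t : {morph al t : a b / a + b}.
Proof.
move=> a b; have N c : al t (- c) = - al t c.
  by rewrite -sub0r alphaTB alphaT_0 sub0r.
by rewrite -{1}(opprK b) alphaTB N opprK.
Qed.

Lemma alphaT0E a : al 0%MM a = a.
Proof.
rewrite /ore_alphaT; elim: (index_enum _) => [|i s IHs]; first by rewrite big_nil.
by rewrite big_cons mnm0E /= IHs.
Qed.

Lemma alphaTDm t w a : al (t + w)%MM a = al t (al w a).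
Proof.
rewrite {1 3}/ore_alphaT.
pose G s t := \big[comp/idfun]_(i <- s) iter (t i) (ore_alpha X i) : R -> R.
rewrite -!/(G _ _).
have Gc s i b : G s t (ore_alpha X i b) = ore_alpha X i (G s t b).
  rewrite /G; elim: s b => [|j s IHs] b; first by rewrite big_nil.
  rewrite big_cons /= IHs; elim: (t j) => //= k ->.
  by rewrite ore_alphaC.
rewrite -/(al w a) {1}/ore_alphaT -/(G (index_enum _) w).
elim: (index_enum _) => [|i s IHs]; first by rewrite /G !big_nil.
rewrite /G !big_cons -!/(G _ _) /= mnmDE iterD IHs; congr iter.
elim: (w i) => //= k ->.
by rewrite Gc.
Qed.

Lemma gr_sum_supp (V : zmodType) (F : 'X_{1..n} -> R -> V) f s :
    uniq s -> {subset gr_supp f <= s} -> (forall t, F t 0 = 0) ->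
  \sum_(t <- gr_supp f) F t (gr_coef f t) = \sum_(t <- s) F t (gr_coef f t).
Proof.
move=> us sub F0; rewrite [RHS](bigID (mem (gr_supp f))) /=.
rewrite [X in _ = _ + X]big1 ?addr0; last first.
  move=> t Nt; rewrite /gr_coef; have /eqP-> : mcoeff t (f : {mpoly R[n]}) == 0.
    by rewrite mcoeff_eq0.
  exact: F0.
rewrite -[RHS]big_filter; apply: perm_big; apply: uniq_perm.
- exact: msupp_uniq.
- exact: filter_uniq.
move=> t; rewrite mem_filter; case: (boolP (t \in gr_supp f)) => tf.
  by rewrite (sub _ tf).
by [].
Qed.

Lemma gr_sumD (V : zmodType) (F : 'X_{1..n} -> R -> V) f g :
    (forall t, {morph F t : a b / a + b}) ->
  \sum_(t <- gr_supp (f + g)) F t (gr_coef (f + g) t) =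
  \sum_(t <- gr_supp f) F t (gr_coef f t) +
  \sum_(t <- gr_supp g) F t (gr_coef g t).
Proof.
move=> FD; have F0 t : F t 0 = 0 by apply: (addrI (F t 0)); rewrite -FD !addr0.
pose s := undup (gr_supp f ++ gr_supp g ++ gr_supp (f + g)).
have us : uniq s by exact: undup_uniq.
rewrite !(gr_sum_supp (s := s)) //.
- rewrite -big_split; apply: eq_bigr => t _ /=; rewrite -FD; congr F.
  exact: mcoeffD.
- by move=> t tf; rewrite mem_undup !mem_cat tf !orbT.
- by move=> t tf; rewrite mem_undup !mem_cat tf.
- by move=> t tf; rewrite mem_undup !mem_cat tf !orbT.
Qed.

Lemma gr_monD t : {morph gr_mon X ^~ t : a b / a + b}.
Proof. by move=> a b; exact: scalerDl. Qed.

Lemma gr_mon0 t : gr_mon X 0 t = 0.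
Proof. exact: scale0r. Qed.

Lemma gr_sum_mon (V : zmodType) (F : 'X_{1..n} -> R -> V) a t :
    F t 0 = 0 ->
  \sum_(w <- gr_supp (gr_mon X a t)) F w (gr_coef (gr_mon X a t) w) = F t a.
Proof.
move=> F0; rewrite /gr_supp /gr_coef /gr_mon.
have [->|a0] := eqVneq a 0.
  by rewrite scale0r msupp0 big_nil.
by rewrite msuppMCX // big_seq1 mcoeffZ mcoeffX eqxx mulr1.
Qed.

Lemma grE f : f = \sum_(t <- gr_supp f) gr_mon X (gr_coef f t) t.
Proof. exact: mpolyE. Qed.

Lemma gr_ind (P : ore_gr X -> Prop) :
  P 0 -> (forall f g, P f -> P g -> P (f + g)) ->
  (forall a t, P (gr_mon X a t)) -> forall f, P f.
Proof.
by move=> P0 PD Pm f; rewrite (grE f); apply: big_ind => // t _; apply: Pm.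
Qed.

Lemma gr_mulDl : left_distributive (@gr_mul _ _ _ X) +%R.
Proof.
move=> f g h; pose F t a := \sum_(w <- gr_supp h)
  gr_mon X (a * al t (gr_coef h w)) (t + w)%MM.
apply: (gr_sumD (F := F)) => t a b; rewrite /F -big_split.
by apply: eq_bigr => w _; rewrite mulrDl gr_monD.
Qed.

Lemma gr_mulDr : right_distributive (@gr_mul _ _ _ X) +%R.
Proof.
move=> h f g; rewrite /gr_mul -big_split; apply: eq_bigr => t _ /=.
pose F w a := gr_mon X (gr_coef h t * al t a) (t + w)%MM.
by apply: (gr_sumD (F := F)) => w a b; rewrite /F alphaTD mulrDr gr_monD.
Qed.

(* The defining rule (a t) * (b w) = a alpha_t(b) (t w). *)
Lemma gr_mul_mon a b t w :
  gr_mul (gr_mon X a t) (gr_mon X b w) = gr_mon X (a * al t b) (t + w)%MM.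
Proof.
pose G t a w b := gr_mon X (a * al t b) (t + w)%MM.
have G0 t' a' w' : G t' a' w' 0 = 0 by rewrite /G alphaT_0 mulr0 gr_mon0.
pose F t a := \sum_(w' <- gr_supp (gr_mon X b w))
  G t a w' (gr_coef (gr_mon X b w) w').
rewrite [LHS](gr_sum_mon (F := F)) /F; first exact: (gr_sum_mon (F := G t a)).
by rewrite big1 // => w' _; rewrite /G mul0r gr_mon0.
Qed.

Lemma gr_mul0 f : gr_mul f 0 = 0.
Proof. by apply: (addrI (gr_mul f 0)); rewrite -gr_mulDr !addr0. Qed.

Lemma gr_0mul f : gr_mul 0 f = 0.
Proof. by apply: (addrI (gr_mul 0 f)); rewrite -gr_mulDl !addr0. Qed.

Lemma gr_mulA : associative (@gr_mul _ _ _ X).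
Proof.
move=> f g h; elim/gr_ind: f => [|f1 f2 H1 H2|a t].
- by rewrite !gr_0mul.
- by rewrite !gr_mulDl H1 H2.
elim/gr_ind: g => [|g1 g2 H1 H2|b w].
- by rewrite !(gr_0mul, gr_mul0).
- by rewrite !(gr_mulDl, gr_mulDr) H1 H2.
elim/gr_ind: h => [|h1 h2 H1 H2|c v].
- by rewrite !gr_mul0.
- by rewrite !gr_mulDr H1 H2.
by rewrite !gr_mul_mon alphaTM alphaTDm mulrA addmA.
Qed.

Lemma gr_mul1l : left_id (gr_mon X 1 0%MM) (@gr_mul _ _ _ X).
Proof.
move=> f; elim/gr_ind: f => [|f1 f2 H1 H2|a t]; first exact: gr_mul0.
  by rewrite gr_mulDr H1 H2.
by rewrite gr_mul_mon alphaT0E mul1r add0m.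
Qed.

Lemma gr_mul1r : right_id (gr_mon X 1 0%MM) (@gr_mul _ _ _ X).
Proof.
move=> f; elim/gr_ind: f => [|f1 f2 H1 H2|a t]; first exact: gr_0mul.
  by rewrite gr_mulDl H1 H2.
by rewrite gr_mul_mon alphaT1 mulr1 addm0.
Qed.

Lemma gr_1neq0 : gr_mon X 1 0%MM != 0.
Proof.
apply/eqP => /(congr1 (fun f => gr_coef f 0%MM)) /eqP.
by rewrite /gr_coef /gr_mon mcoeff0 mcoeffZ mcoeffX eqxx mulr1 oner_eq0.
Qed.

HB.instance Definition _ := GRing.Zmodule_isNzRing.Build (ore_gr X)
  gr_mulA gr_mul1l gr_mul1r gr_mulDl gr_mulDr gr_1neq0.

End GradedRing.

(* The element \sum_t f_t Y^t of E with coordinates f: as left R-modules, E and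
   ore_gr X are identified along this bijection. *)
Definition ore_val (R E : nzRingType) (n : nat) (X : ore_ext R E n)
    (f : ore_gr X) : E :=
  \sum_(t <- gr_supp f)
    oreC X (gr_coef f t) * \prod_(i < n) oreY X i ^+ t i.

Section FreeModule.
Variables (R E : nzRingType) (n : nat) (X : ore_ext R E n).
Implicit Types (f g : ore_gr X) (t w : 'X_{1..n}) (a b : R).
Local Notation Y := (oreY X).
Local Notation level := (ore_level (oreC X) Y).
Local Notation mon t := (\prod_(i < n) Y i ^+ t i).

Lemma oreYC i j : GRing.comm (Y i) (Y j).
Proof.
wlog ij : i j / (i < j)%N.
  move=> H; case: (ltngtP i j) => ij; first exact: H.
    by apply/commr_sym/H.
  by rewrite (val_inj ij).
apply: commr_sym; rewrite /GRing.comm (ore_step_comm (ore_stepP X j)).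
  by rewrite oreA_Y // oreD_Y // addr0.
by apply: SubringGen; right; exists i.
Qed.

Lemma oreYmonD t w : mon (t + w)%MM = mon t * mon w.
Proof.
rewrite -prodrM_comm => [|i j _ _]; last exact/commrX/commr_sym/commrX/oreYC.
by apply: eq_bigr => i _; rewrite mnmDE exprD.
Qed.

Lemma oreYmonU i k : mon (U_(i) *+ k)%MM = Y i ^+ k.
Proof.
rewrite -(big_pred1_eq *%R i (fun j => Y j ^+ k)) big_mkcond.
apply: eq_bigr => j _; rewrite mulmnE mnm1E eq_sym.
by case: eqP => _; rewrite ?mul1n ?mul0n.
Qed.

Lemma ore_valD : {morph @ore_val _ _ _ X : f g / f + g}.
Proof.
move=> f g; pose F t a := oreC X a * mon t.
by apply: (gr_sumD (F := F)) => t a b; rewrite /F rmorphD mulrDl.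
Qed.

Lemma ore_val_mon a t : ore_val (gr_mon X a t) = oreC X a * mon t.
Proof.
pose F t a := oreC X a * mon t.
by apply: (gr_sum_mon X (F := F)); rewrite /F rmorph0 mul0r.
Qed.

Lemma ore_val0 : ore_val (0 : ore_gr X) = 0.
Proof. by rewrite -(gr_mon0 X 0%MM) ore_val_mon rmorph0 mul0r. Qed.

Lemma ore_val_sum (I : Type) (s : seq I) (P : pred I) (F : I -> ore_gr X) :
  ore_val (\sum_(i <- s | P i) F i) = \sum_(i <- s | P i) ore_val (F i).
Proof. exact: (big_morph _ ore_valD ore_val0). Qed.

Lemma ore_val_mulYX f i k : exists g, ore_val f * Y i ^+ k = ore_val g.
Proof.
elim/gr_ind: f => [|f1 f2 [g1 H1] [g2 H2]|a t].
- by exists 0; rewrite ore_val0 mul0r.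
- by exists (g1 + g2); rewrite !ore_valD mulrDl H1 H2.
exists (gr_mon X a (t + U_(i) *+ k)%MM).
by rewrite !ore_val_mon oreYmonD oreYmonU mulrA.
Qed.

Lemma ore_val_surj x : exists f, x == ore_val f.
Proof.
suff H k : (k <= n)%N -> forall y, level k y -> exists f, y = ore_val f.
  by have [f ->] := H n (leqnn n) x (ore_levelT X x); exists f.
elim: k => [|k IHk] kn y.
  move=> H; have [a ->] : exists a, y = oreC X a.
    elim: H => {y} [y [[a ->]|[]//]||y z _ [a ->] _ [b ->]|y z _ [a ->] _ [b ->]].
    - by exists a.
    - by exists 1; rewrite rmorph1.
    - by exists (a - b); rewrite rmorphB.
    - by exists (a * b); rewrite rmorphM.
  exists (gr_mon X a 0%MM); rewrite ore_val_mon big1 ?mulr1 // => i _.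
  by rewrite mnm0E.
move=> /(ore_step_gen (ore_stepP X (Ordinal kn)))[p [pP ->]].
rewrite horner_coef; apply: (big_ind (fun z => exists f, z = ore_val f)).
- by exists 0; rewrite ore_val0.
- by move=> ? ? [f ->] [g ->]; exists (f + g); rewrite ore_valD.
move=> j _; have [f ->] := IHk (ltnW kn) _ (pP j).
by have [g ->] := ore_val_mulYX f (Ordinal kn) j; exists g.
Qed.

Lemma subring_gen0 (G : E -> Prop) : subring_gen G 0.
Proof. by rewrite -(subrr 1); apply: SubringB; apply: Subring1. Qed.

Lemma subring_genD (G : E -> Prop) x y :
  subring_gen G x -> subring_gen G y -> subring_gen G (x + y).
Proof.
move=> Gx Gy; rewrite -[y]opprK -[- y]sub0r; apply: SubringB => //.
by apply: SubringB => //; apply: subring_gen0.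
Qed.

Lemma level_val k f :
  (forall t, t \in gr_supp f -> forall i : 'I_n, (k <= i)%N -> t i = 0%N) ->
  level k (ore_val f).
Proof.
move=> fk; rewrite /ore_val big_seq; apply: (big_ind (level k)) => [|x y|t /fk tk].
- exact: subring_gen0.
- exact: subring_genD.
apply: SubringM; first by apply: SubringGen; left; exists (gr_coef f t).
apply: (big_ind (level k)) => [|x y|i _]; [exact: Subring1|exact: SubringM|].
have [/tk->|ik] := leqP k i; first exact: Subring1.
elim: (t i) => [|j IHj]; first exact: Subring1.
by rewrite exprS; apply: SubringM => //; apply: SubringGen; right; exists i.
Qed.

Lemma ore_val_ker k f : (k <= n)%N ->
  (forall t, t \in gr_supp f -> forall i : 'I_n, (k <= i)%N -> t i = 0%N) ->
  ore_val f = 0 -> f = 0.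
Proof.
elim: k f => [|k IHk] f kn fk f0.
  have t0 t : t \in gr_supp f -> t = 0%MM.
    by move=> /fk H; apply/mnmP => i; rewrite H // mnm0E.
  have Ef : f = gr_mon X (gr_coef f 0%MM) 0%MM.
    rewrite [LHS]grE (gr_sum_supp (F := fun t a => gr_mon X a t)
      (s := [:: 0%MM])) ?big_seq1 // => [t /t0->|t]; first exact: mem_head.
    exact: gr_mon0.
  move: f0; rewrite Ef ore_val_mon big1 => [|i _]; last by rewrite mnm0E.
  rewrite mulr1 -(rmorph0 (oreC X)) => /oreC_inj ->.
  exact: gr_mon0.
pose i0 := Ordinal kn; pose D := (\max_(t <- gr_supp f) t i0).+1.
pose sl j : ore_gr X := \sum_(t <- gr_supp f | t i0 == j)
  gr_mon X (gr_coef f t) (t - U_(i0) *+ j)%MM.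
have slk j t : t \in gr_supp (sl j) -> forall i : 'I_n, (k <= i)%N -> t i = 0%N.
  move=> /msupp_sum_le/flattenP[/= s /mapP[w]].
  rewrite mem_filter => /andP[/eqP wj wf] ->.
  move=> /msuppZ_le; rewrite msuppX inE => /eqP-> i ki.
  rewrite mnmBE mulmnE mnm1E; case: eqVneq => [<-|ni].
    by rewrite mul1n wj subnn.
  rewrite mul0n subn0 (fk _ wf) // ltn_neqAle ki andbT.
  by apply: contra_neq ni => E0; apply: val_inj.
have f_sl : ore_val f = \sum_(j < D) ore_val (sl j) * Y i0 ^+ j.
  rewrite [in LHS](grE f) ore_val_sum.
  under [RHS]eq_bigr => j _ do rewrite ore_val_sum mulr_suml.
  rewrite (exchange_big_dep xpredT) //= big_seq [RHS]big_seq.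
  apply: eq_bigr => t tf.
  have tD : (t i0 < D)%N.
    by rewrite ltnS; apply: (leq_bigmax_seq (F := fun t : 'X_{1..n} => t i0)).
  rewrite (big_pred1 (Ordinal tD)) => [|j]; last by rewrite eq_sym.
  rewrite !ore_val_mon -mulrA /=; congr (_ * _).
  rewrite -{1}[t](@submK _ (U_(i0) *+ t i0)); last first.
    apply/mnm_lepP => i; rewrite mulmnE mnm1E.
    by case: eqVneq => [->|]; rewrite ?mul1n ?mul0n.
  by rewrite oreYmonD oreYmonU.
pose p := \poly_(j < D) ore_val (sl j).
have p0 : p = 0.
  apply: (ore_step_free (ore_stepP X i0)) => [j|j|].
  - rewrite coef_poly; case: ifP => _; last exact: subring_gen0.
    exact/level_val/slk.
  - rewrite coef0; exact: subring_gen0.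
  - by rewrite horner_poly -f_sl f0 horner0.
have sl0 j : sl j = 0.
  have [jD|Dj] := ltnP j D.
    apply: IHk (ltnW kn) (slk j) _.
    by have := congr1 (fun q : {poly E} => q`_j) p0; rewrite coef_poly jD coef0.
  rewrite /sl big_seq_cond big1 // => t /andP[tf /eqP tj].
  have := leq_bigmax_seq (F := fun t : 'X_{1..n} => t i0) t tf isT.
  by rewrite tj leqNgt Dj.
apply/mpolyP => t; rewrite mcoeff0.
have [tf|] := boolP (t \in gr_supp f); last by rewrite -mcoeff_eq0 => /eqP.
have := congr1 (mcoeff (t - U_(i0) *+ t i0)%MM) (sl0 (t i0)).
rewrite mcoeff0 raddf_sum big_mkcond (bigD1_seq t) ?msupp_uniq //= eqxx.
rewrite mcoeffZ mcoeffX eqxx mulr1 big1 ?addr0 // => w wt.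
case: eqVneq => // wi; rewrite mcoeffZ mcoeffX; case: eqVneq => [E0|_]; last by rewrite mulr0.
case/eqP: wt; apply/mnmP => i; move/mnmP/(_ i): E0.
rewrite !mnmBE !mulmnE mnm1E; case: eqVneq => [<-|_]; first by rewrite wi.
by rewrite !mul0n !subn0.
Qed.

Lemma ore_val_inj : injective (@ore_val _ _ _ X).
Proof.
move=> f g fg; apply/eqP; rewrite -subr_eq0; apply/eqP.
apply: (@ore_val_ker n) => // [t _ i|]; first by rewrite leqNgt ltn_ord.
by apply: (addIr (ore_val g)); rewrite -ore_valD subrK add0r.
Qed.

End FreeModule.

Definition ore_coord (R E : nzRingType) (n : nat) (X : ore_ext R E n) (x : E)
    : ore_gr X := xchoose (ore_val_surj X x).

Lemma ore_coordK (R E : nzRingType) (n : nat) (X : ore_ext R E n) :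
  cancel (ore_coord X) (@ore_val R E n X).
Proof. by move=> x; apply/esym/eqP/(xchooseP (ore_val_surj X x)). Qed.

Lemma ore_valK (R E : nzRingType) (n : nat) (X : ore_ext R E n) :
  cancel (@ore_val R E n X) (ore_coord X).
Proof. by move=> f; apply: ore_val_inj; rewrite ore_coordK. Qed.

Record term_order (n : nat) (le : rel 'X_{1..n}) : Prop := TermOrder {
  term_order_total : total le;
  term_order_anti : antisymmetric le;
  term_order_trans : transitive le;
  term_order_wf : well_founded (fun t w => (t != w) && le t w);
  term_order_mul : forall v t w, le t w -> le (v + t)%MM (v + w)%MM }.

(* The pair (t, i) stands for the term t e_i. *)
Record module_term_order (n m : nat) (le : rel 'X_{1..n})
    (lem : rel ('X_{1..n} * 'I_m)) : Prop := ModuleTermOrder {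
  mterm_order_total : total lem;
  mterm_order_anti : antisymmetric lem;
  mterm_order_trans : transitive lem;
  mterm_order_wf : well_founded (fun x y => (x != y) && lem x y);
  mterm_order_mul : forall t w x y, le t w -> lem x y ->
    lem ((t + x.1)%MM, x.2) ((w + y.1)%MM, y.2) }.

(* The coefficient of f at the term x.1 e_(x.2). *)
Definition ore_mcoef (R E : nzRingType) (n m : nat) (X : ore_ext R E n)
    (f : 'rV[E]_m) (x : 'X_{1..n} * 'I_m) : R :=
  gr_coef (ore_coord X (f 0 x.2)) x.1.

(* M(f) = a t e_j. *)
Definition is_lead_mon (R E : nzRingType) (n m : nat) (X : ore_ext R E n)
    (lem : rel ('X_{1..n} * 'I_m)) (f : 'rV[E]_m)
    (a : R) (t : 'X_{1..n}) (j : 'I_m) : Prop :=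
  [/\ a != 0, ore_mcoef X f (t, j) = a
    & forall x, ore_mcoef X f x != 0 -> lem x (t, j)].

Definition gr_vmon (R E : nzRingType) (n m : nat) (X : ore_ext R E n)
    (a : R) (t : 'X_{1..n}) (j : 'I_m) : 'rV[ore_gr X]_m :=
  \row_(k < m) if k == j then gr_mon X a t else 0.

Definition in_syz (R E : nzRingType) (n m s : nat) (X : ore_ext R E n)
    (c : 'I_s -> R) (tau : 'I_s -> 'X_{1..n}) (l : 'I_s -> 'I_m)
    (h : 'rV[ore_gr X]_s) : Prop :=
  \sum_(i < s) h 0 i *: gr_vmon X (c i) (tau i) (l i) = 0.

Definition syz_homog (R E : nzRingType) (n m s : nat) (X : ore_ext R E n)
    (tau : 'I_s -> 'X_{1..n}) (l : 'I_s -> 'I_m) (h : 'rV[ore_gr X]_s)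
    : Prop :=
  exists (a : 'I_s -> R) (lam : 'I_s -> 'X_{1..n}) (x : 'X_{1..n} * 'I_m),
    h = \row_(i < s) gr_mon X (a i) (lam i) /\
    forall i, a i != 0 -> ((lam i + tau i)%MM, l i) = x.

Definition append0 (A : nzRingType) (s : nat) (v : 'rV[A]_s) : 'rV[A]_s.+1 :=
  \row_(j < s.+1) oapp (v 0) 0 (unlift ord_max j).

(* In the definitions below the last of the s.+1 indices is ord_max. *)

Definition lcm_set (n s : nat) (tau : 'I_s -> 'X_{1..n}) (H : {set 'I_s})
    : 'X_{1..n} :=
  \big[@mlcm n/0%MM]_(i in H) tau i.

Definition maximal_for (n m s : nat) (tau : 'I_s -> 'X_{1..n})
    (l : 'I_s -> 'I_m) (H : {set 'I_s}) (d : 'X_{1..n}) (e : 'I_m) : bool :=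
  H == [set i | (tau i <= d)%MM && (l i == e)].

(* As ord_max \in H, the common value of l on H is l ord_max. *)
Definition basic_set (n m s : nat) (tau : 'I_s.+1 -> 'X_{1..n})
    (l : 'I_s.+1 -> 'I_m) (H : {set 'I_s.+1}) : bool :=
  [&& ord_max \in H, [forall i in H, forall j in H, l i == l j]
    & maximal_for tau l H (lcm_set tau H) (l ord_max)].

Definition alpha_set (R E : nzRingType) (n s : nat) (X : ore_ext R E n)
    (tau : 'I_s -> 'X_{1..n}) (H : {set 'I_s}) (i : 'I_s) : R -> R :=
  ore_alphaT X (lcm_set tau H - tau i)%MM.

Definition in_colon (R E : nzRingType) (n s : nat) (X : ore_ext R E n)
    (c : 'I_s.+1 -> R) (tau : 'I_s.+1 -> 'X_{1..n}) (H : {set 'I_s.+1})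
    (d : R) : Prop :=
  left_ideal_gen
    (fun x => exists2 i, i \in H :\ ord_max & x = alpha_set X tau H i (c i))
    (d * alpha_set X tau H ord_max (c ord_max)).

Definition assoc_syz (R E : nzRingType) (n s : nat) (X : ore_ext R E n)
    (c : 'I_s.+1 -> R) (tau : 'I_s.+1 -> 'X_{1..n}) (H : {set 'I_s.+1})
    (ds : R) (D : 'rV[ore_gr X]_s.+1) : Prop :=
  exists d : 'I_s.+1 -> R,
    ds * alpha_set X tau H ord_max (c ord_max) =
      - \sum_(i in H :\ ord_max) d i * alpha_set X tau H i (c i) /\
    D = \sum_(i in H :\ ord_max) gr_vmon X (d i) (lcm_set tau H - tau i)%MM i
        + gr_vmon X ds (lcm_set tau H - tau ord_max)%MM ord_max.

(* Main.v *)
(* Let h be a syzygy of the first s leading monomials. For each term t of its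
   last coordinate, the relation at the term t tau_s e_(l_s) only involves the
   indices H of the leading terms dividing it, and H is basic. Twisting by the
   inverse of alpha_w, where w = t tau_s / tau_H, turns this relation into one
   putting the pulled-back coefficient in the colon ideal of H. Hence an
   S-combination of the D_(jH) has the same last coordinate as h, and the
   difference is a syzygy of the first s-1 leading monomials. *)
Require Import Defs.
From mathcomp Require Import all_boot all_order all_algebra.
From mathcomp.multinomials Require Import mpoly.

Import GRing.Theory.
Local Open Scope ring_scope.

Set Implicit Arguments.
Unset Strict Implicit.
Unset Printing Implicit Defensive.

(** * Spans as submodules *)

Section Span.
Variables (A : nzRingType) (V : lmodType A) (X : V -> Prop).

Lemma lspan0 : lspan X 0.
Proof.
exists 0%N, (fun=> 0), (fun=> 0); split; first by case.
by rewrite big_ord0.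
Qed.

Lemma mem_lspan v : X v -> lspan X v.
Proof.
move=> Xv; exists 1%N, (fun=> 1), (fun=> v).
by split=> //; rewrite big_ord1 scale1r.
Qed.

Lemma lspanD v w : lspan X v -> lspan X w -> lspan X (v + w).
Proof.
move=> [k [a [x [Xx ->]]]] [k' [a' [x' [Xx' ->]]]].
exists (k + k')%N, (fun i => match split i with inl j => a j | inr j => a' j end),
  (fun i => match split i with inl j => x j | inr j => x' j end); split.
  by move=> i; case: (split i).
rewrite big_split_ord; congr (_ + _); apply: eq_bigr => i _.
  by rewrite (unsplitK (inl i)).
by rewrite (unsplitK (inr i)).
Qed.

Lemma lspanZ b v : lspan X v -> lspan X (b *: v).
Proof.
move=> [k [a [x [Xx ->]]]]; exists k, (fun i => b * a i), x; split=> //.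
by rewrite scaler_sumr; apply: eq_bigr => i _; rewrite scalerA.
Qed.

Lemma lspan_sum (I : Type) (r : seq I) (P : pred I) (F : I -> V) :
  (forall i, P i -> lspan X (F i)) -> lspan X (\sum_(i <- r | P i) F i).
Proof. by move=> XF; apply: big_ind => //; [apply: lspan0 | apply: lspanD]. Qed.

(** Serves as an induction principle: a property of vectors passes from the generators to their
    whole span as soon as it defines a submodule. *)
Lemma lspan_min (N : V -> Prop) :
    N 0 -> (forall v w, N v -> N w -> N (v + w)) ->
    (forall a v, N v -> N (a *: v)) -> (forall v, X v -> N v) ->
  forall v, lspan X v -> N v.
Proof.
move=> N0 ND NZ NX _ [k [a [x [Xx ->]]]].
by apply: (big_ind N) => // i _; apply/NZ/NX.
Qed.

End Span.

(** * Least common multiples of terms, and basic sets *)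

Section LcmSet.
Variables (n s : nat) (tau : 'I_s -> 'X_{1..n}).
Implicit Types (H : {set 'I_s}) (d : 'X_{1..n}).

Lemma lcm_setE H k : lcm_set tau H k = (\max_(i in H) tau i k)%N.
Proof.
apply: (big_morph (fun v : 'X_{1..n} => v k)) => [v w|]; last exact: mnm0E.
by rewrite mnmE.
Qed.

Lemma lcm_set_le H d :
  (lcm_set tau H <= d)%MM = [forall i in H, (tau i <= d)%MM].
Proof.
apply/mnm_lepP/forall_inP => [Hd i iH|Hd k].
  apply/mnm_lepP => k; apply: leq_trans (Hd k); rewrite lcm_setE.
  exact: (leq_bigmax_cond (F := fun i => tau i k)).
by rewrite lcm_setE; apply/bigmax_leqP => i /Hd/mnm_lepP.
Qed.

Lemma lcm_set_ge H i : i \in H -> (tau i <= lcm_set tau H)%MM.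
Proof.
move=> iH; have := lepm_refl (lcm_set tau H).
by rewrite lcm_set_le => /forall_inP/(_ i iH).
Qed.

End LcmSet.

(** The lcm of these [tau i] divides [d], so a term dividing the lcm also divides [d]; maximality
    for [d] thus gives maximality for the lcm itself. *)
Lemma divisors_basic (n m s : nat) (tau : 'I_s.+1 -> 'X_{1..n})
    (l : 'I_s.+1 -> 'I_m) (d : 'X_{1..n}) :
  (tau ord_max <= d)%MM ->
  basic_set tau l [set i | (tau i <= d)%MM && (l i == l ord_max)].
Proof.
move=> sd; set H := [set i | _].
have Hd : (lcm_set tau H <= d)%MM.
  by rewrite lcm_set_le; apply/forall_inP => i; rewrite inE => /andP[].
apply/and3P; split; first by rewrite inE sd eqxx.
  apply/forall_inP => i; rewrite inE => /andP[_ /eqP ->].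
  by apply/forall_inP => j; rewrite inE => /andP[_ /eqP ->].
apply/eqP/setP => i; apply/idP/idP => [iH|]; rewrite !inE.
  by rewrite (lcm_set_ge tau iH) /=; move: iH; rewrite inE => /andP[].
by case/andP => iH ->; rewrite (lepm_trans iH Hd).
Qed.

(** * Monomials and coefficients in the graded Ore extension *)

Section GradedOre.
Variables (R E : nzRingType) (n : nat) (X : ore_ext R E n).
Implicit Types (f g : ore_gr X) (t w : 'X_{1..n}) (a b : R).

Lemma gr_coefD t : {morph @gr_coef _ _ _ X ^~ t : f g / f + g}.
Proof. by move=> f g; apply: mcoeffD. Qed.

Lemma gr_coef0 t : gr_coef (0 : ore_gr X) t = 0.
Proof. exact: mcoeff0. Qed.

Lemma gr_coef_mon a t w : gr_coef (gr_mon X a t) w = if t == w then a else 0.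
Proof.
by rewrite /gr_coef /gr_mon mcoeffZ mcoeffX; case: eqP; rewrite ?mulr1 ?mulr0.
Qed.

Lemma gr_monM a b t w :
  gr_mon X a t * gr_mon X b w = gr_mon X (a * ore_alphaT X t b) (t + w)%MM.
Proof. exact: gr_mul_mon. Qed.

Lemma gr_mon_sum (I : Type) (r : seq I) (P : pred I) (a : I -> R) t :
  gr_mon X (\sum_(i <- r | P i) a i) t = \sum_(i <- r | P i) gr_mon X (a i) t.
Proof. exact: (big_morph _ (gr_monD X t) (gr_mon0 X t)). Qed.

(** Terms form a cancellative monoid, so at most one term v of [f] satisfies v w = t, and that same
    v twists [b]. *)
Lemma gr_coef_mulmon f b w t :
  gr_coef (f * gr_mon X b w) t =
  if (w <= t)%MM then gr_coef f (t - w)%MM * ore_alphaT X (t - w)%MM b else 0.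
Proof.
elim/gr_ind: f => [|f g Hf Hg|a v].
- by rewrite mul0r !gr_coef0 mul0r if_same.
- rewrite mulrDl !gr_coefD Hf Hg; case: ifP; rewrite ?addr0 //.
  by rewrite mulrDl.
rewrite gr_monM !gr_coef_mon; case: (boolP (w <= t)%MM) => wt.
  (* Writing [t] as (t - w) + w makes [w] cancellable in the comparison of terms. *)
  rewrite -{1}(submK wt); case: (eqVneq v (t - w)%MM) => [->|vt].
    by rewrite eqxx.
  by rewrite eqm_add2r (negbTE vt) mul0r.
by case: eqP => // vwt; rewrite -vwt lem_addl in wt.
Qed.

Lemma alphaT_bij t :
  (forall i, bijective (ore_alpha X i)) -> bijective (ore_alphaT X t).
Proof.
move=> X_aut; apply: (alphaT_rec (P := fun F => bijective F)).
  exact: (Bijective (fun=> erefl) (fun=> erefl)).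
by move=> i F Fb; apply: bij_comp.
Qed.

Lemma alphaT_sum (I : Type) (r : seq I) (P : pred I) (F : I -> R) t :
  ore_alphaT X t (\sum_(i <- r | P i) F i) =
  \sum_(i <- r | P i) ore_alphaT X t (F i).
Proof. exact: (big_morph _ (alphaTD X t) (alphaT_0 X t)). Qed.

Lemma gr_vmon_sum (m : nat) (I : Type) (r : seq I) (P : pred I) (a : I -> R) t
    (j : 'I_m) :
  gr_vmon X (\sum_(i <- r | P i) a i) t j =
  \sum_(i <- r | P i) gr_vmon X (a i) t j.
Proof.
apply/rowP => k; rewrite summxE !mxE gr_mon_sum.
by case: eqP => [->|jk]; [apply: eq_bigr => i _ | rewrite big1 // => i _];
   rewrite mxE ?eqxx //; case: eqP.
Qed.

Lemma gr_vmon0 (m : nat) t (j : 'I_m) : gr_vmon X 0 t j = 0.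
Proof. by apply/rowP => k; rewrite !mxE gr_mon0 if_same. Qed.

Lemma scale_gr_vmon (m : nat) a b t w (j : 'I_m) :
  gr_mon X a t *: gr_vmon X b w j =
  gr_vmon X (a * ore_alphaT X t b) (t + w)%MM j.
Proof.
apply/rowP => k; rewrite !mxE; case: eqP => _; [exact: gr_monM | exact: mulr0].
Qed.

(** * The syzygy module of a family of monomials *)

Section Syzygies.
Variables (m s : nat) (c : 'I_s -> R) (tau : 'I_s -> 'X_{1..n}).
Variable l : 'I_s -> 'I_m.
Local Notation syz := (in_syz (X := X) c tau l).

Lemma in_syz0 : syz 0.
Proof. by rewrite /in_syz big1 // => i _; rewrite mxE scale0r. Qed.

Lemma in_syzD h k : syz h -> syz k -> syz (h + k).
Proof.
rewrite /in_syz => h0 k0; under eq_bigr do rewrite mxE scalerDl.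
by rewrite big_split /= h0 k0 addr0.
Qed.

Lemma in_syzZ f h : syz h -> syz (f *: h).
Proof.
rewrite /in_syz => h0; under eq_bigr do rewrite mxE -scalerA.
by rewrite -scaler_sumr h0 scaler0.
Qed.

Lemma in_syz_span (B : 'rV[ore_gr X]_s -> Prop) :
  (forall v, B v -> syz v) -> forall v, lspan B v -> syz v.
Proof.
by apply: lspan_min; [apply: in_syz0 | apply: in_syzD | apply: in_syzZ].
Qed.

(** This is the coefficient of the syzygy relation at the term [d] e_[e]: only the indices in the
    sum can reach that term, each through the single term [d - tau i] of its coordinate. *)
Lemma in_syz_coef h d e : syz h ->
  \sum_(i | (tau i <= d)%MM && (l i == e))
    gr_coef (h 0 i) (d - tau i)%MM * ore_alphaT X (d - tau i)%MM (c i) = 0.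
Proof.
move=> /(congr1 (fun v : 'rV_m => gr_coef (v 0 e) d)).
rewrite mxE gr_coef0 summxE => h0; rewrite -[RHS]h0.
rewrite (big_morph _ (gr_coefD d) (gr_coef0 d)) big_mkcond.
apply: eq_bigr => i _; rewrite !mxE [e == _]eq_sym andbC.
case: eqP => _ /=; first by rewrite gr_coef_mulmon.
by rewrite mulr0 gr_coef0.
Qed.

End Syzygies.

(** * Adjoining one more leading monomial *)

Section Step.
Variables (m s : nat) (c : 'I_s.+1 -> R) (tau : 'I_s.+1 -> 'X_{1..n}).
Variable l : 'I_s.+1 -> 'I_m.
Implicit Type H : {set 'I_s.+1}.
Local Notation syz := (in_syz (X := X) c tau l).

Lemma append0_lift (v : 'rV[ore_gr X]_s) i : append0 v 0 (lift ord_max i) = v 0 i.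
Proof. by rewrite mxE liftK. Qed.

Lemma append0_max (v : 'rV[ore_gr X]_s) : append0 v 0 ord_max = 0.
Proof. by rewrite mxE unlift_none. Qed.

(** The primed data are compared pointwise because, in the application, both families restrict a
    common one along different embeddings of ordinals. *)
Lemma in_syz_append0 c' tau' l' v :
    c' =1 c \o lift ord_max -> tau' =1 tau \o lift ord_max ->
    l' =1 l \o lift ord_max ->
  in_syz c' tau' l' v <-> syz (append0 v).
Proof.
move=> cE tauE lE.
(* [big_ord_recr] produces [widen_ord], whereas [append0] is described through [lift]. *)
have liftE (i : 'I_s) : widen_ord (leqnSn s) i = lift ord_max i.
  by apply: val_inj; rewrite /= /bump leqNgt ltn_ord.
rewrite /in_syz big_ord_recr /= append0_max scale0r addr0.
by under [X in _ <-> X = _]eq_bigr do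
  rewrite liftE append0_lift -[c _]cE -[tau _]tauE -[l _]lE.
Qed.

Lemma append0_span (B : 'rV[ore_gr X]_s -> Prop) v :
  lspan B v -> lspan (fun x => exists2 v, B v & x = append0 v) (append0 v).
Proof.
move: v; apply: lspan_min => [|v v' Bv Bv'|f v Bv|v Bv].
- rewrite (_ : append0 0 = 0); first exact: lspan0.
  by apply/rowP => i; rewrite !mxE; case: unlift => //= j; rewrite mxE.
- rewrite (_ : append0 (v + v') = append0 v + append0 v'); first exact: lspanD.
  by apply/rowP => i; rewrite !mxE; case: unlift => [j|] /=; rewrite ?mxE ?addr0.
- rewrite (_ : append0 (f *: v) = f *: append0 v); first exact: lspanZ.
  by apply/rowP => i; rewrite !mxE; case: unlift => [j|] /=; rewrite ?mxE ?mulr0.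
by apply: mem_lspan; exists v.
Qed.

Lemma syz_homog_append0 tau' l' (v : 'rV[ore_gr X]_s) :
    tau' =1 tau \o lift ord_max -> l' =1 l \o lift ord_max ->
  syz_homog tau' l' v -> syz_homog tau l (append0 v).
Proof.
move=> tauE lE [a [lam [x [-> ax]]]].
(* The coefficient 0 at the last index makes homogeneity vacuous there, so the default term [0%MM]
   is arbitrary. *)
exists (fun i => oapp a 0 (unlift ord_max i)),
  (fun i => oapp lam 0%MM (unlift ord_max i)), x; split.
  apply/rowP => i; rewrite !mxE; case: unliftP => [j|] _ /=; first by rewrite mxE.
  by rewrite gr_mon0.
move=> i; case: unliftP => [j -> /ax|_] /=; last by rewrite eqxx.
by rewrite tauE lE.
Qed.

(** Treats the last index on the same footing as the others, so that later arguments can work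
    coordinate by coordinate. *)
Lemma assoc_syzP H ds (D : 'rV[ore_gr X]_s.+1) :
    ord_max \in H -> assoc_syz c tau H ds D ->
  exists d : 'I_s.+1 -> R,
  [/\ d ord_max = ds, \sum_(i in H) d i * alpha_set X tau H i (c i) = 0
    & D = \row_i gr_mon X (if i \in H then d i else 0) (lcm_set tau H - tau i)%MM].
Proof.
(* The given [d] is unconstrained at [ord_max], hence it is overwritten there by [ds]. *)
move=> sH [d [dsE ->]]; exists (fun i => if i == ord_max then ds else d i).
split; first by rewrite eqxx.
  rewrite (big_setD1 ord_max sH) /= eqxx dsE addrC; apply/eqP.
  rewrite subr_eq0; apply/eqP; apply: eq_bigr => i.
  by rewrite !inE => /andP[/negbTE-> _].
apply/rowP => i; rewrite !mxE summxE.
under eq_bigr => j _ do rewrite mxE.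
have [->|i_max] := eqVneq i ord_max.
  rewrite sH big1 ?add0r // => j; rewrite !inE eq_sym.
  by case/andP => /negbTE->.
rewrite addr0; case: ifP => iH.
  rewrite (bigD1 i) ?inE ?i_max //= eqxx big1 ?addr0 // => j /andP[_].
  by rewrite eq_sym => /negbTE->.
rewrite gr_mon0 big1 // => j; rewrite !inE => /andP[_ jH].
by case: eqP => // ij; rewrite ij jH in iH.
Qed.

Lemma basic_set_l H i : basic_set tau l H -> i \in H -> l i = l ord_max.
Proof.
case/and3P=> sH /forall_inP lH _ iH.
by have /forall_inP/(_ _ sH)/eqP := lH i iH.
Qed.

Lemma assoc_syz_homog H ds (D : 'rV[ore_gr X]_s.+1) :
  basic_set tau l H -> assoc_syz c tau H ds D -> syz_homog tau l D.
Proof.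
move=> Hb; have /and3P[sH _ _] := Hb; move=> /(assoc_syzP sH)[d [_ _ ->]].
exists (fun i => if i \in H then d i else 0),
  (fun i => lcm_set tau H - tau i)%MM, (lcm_set tau H, l ord_max).
split=> // i; case: ifP => [iH _|_]; last by rewrite eqxx.
by rewrite submK ?(basic_set_l Hb iH) // lcm_set_ge.
Qed.

(** All products fall on the one term tau_H e_(l_s), where their coefficients add up to the relation
    in [assoc_syzP]. *)
Lemma assoc_syz_in_syz H ds (D : 'rV[ore_gr X]_s.+1) :
  basic_set tau l H -> assoc_syz c tau H ds D -> syz D.
Proof.
move=> Hb; have /and3P[sH _ _] := Hb; move=> /(assoc_syzP sH)[d [_ d0 ->]].
rewrite /in_syz -[RHS](gr_vmon0 (lcm_set tau H) (l ord_max)) -[in RHS]d0.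
rewrite gr_vmon_sum [RHS]big_mkcond; apply: eq_bigr => i _.
rewrite mxE scale_gr_vmon; case: ifP => iH; last by rewrite mul0r gr_vmon0.
by rewrite submK ?(basic_set_l Hb iH) // lcm_set_ge.
Qed.

Lemma assoc_syz_max H ds (D : 'rV[ore_gr X]_s.+1) :
  ord_max \in H -> assoc_syz c tau H ds D ->
  D 0 ord_max = gr_mon X ds (lcm_set tau H - tau ord_max)%MM.
Proof. by move=> sH /(assoc_syzP sH)[d [<- _ ->]]; rewrite mxE sH. Qed.

(** For i in [H] the twist at d / tau_i factors as alpha_w after alpha_(H,i). Inverting alpha_w
    therefore leaves a relation between the alpha_(H,i)(c_i) alone, with [w] independent of i. *)
Lemma syz_in_colon h t : (forall i, bijective (ore_alpha X i)) -> syz h ->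
  exists H w b, [/\ basic_set tau l H, in_colon X c tau H b,
    (w + (lcm_set tau H - tau ord_max) = t)%MM
    & gr_coef (h 0 ord_max) t = ore_alphaT X w b].
Proof.
move=> X_aut h0; set d := (t + tau ord_max)%MM.
set H := [set i | (tau i <= d)%MM && (l i == l ord_max)].
have Hb : basic_set tau l H by apply: divisors_basic; exact: lem_addl.
have /and3P[sH _ _] := Hb.
have Hd : (lcm_set tau H <= d)%MM.
  by rewrite lcm_set_le; apply/forall_inP => i; rewrite inE => /andP[].
set w := (d - lcm_set tau H)%MM.
have wE i : i \in H -> (d - tau i = w + (lcm_set tau H - tau i))%MM.
  by move=> iH; rewrite addmBA ?lcm_set_ge // submK.
have [be alK beK] := alphaT_bij w X_aut.
have dE : (d - tau ord_max = t)%MM by rewrite /d addmK.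
pose b i := be (gr_coef (h 0 i) (d - tau i)%MM).
exists H, w, (b ord_max); split=> //; last by rewrite /b beK dE.
  have : \sum_(i in H) b i * alpha_set X tau H i (c i) = 0.
    (* Applying the injective alpha_w turns the claim into the coefficient relation of [h] at
       [d]. *)
    apply: (can_inj alK); rewrite alphaT_0 alphaT_sum.
    rewrite -[RHS](in_syz_coef d (l ord_max) h0).
    apply: eq_big => [i|i iH]; first by rewrite inE.
    by rewrite alphaTM beK -alphaTDm -wE.
  rewrite (big_setD1 ord_max sH) /= => /eqP; rewrite addr_eq0 => /eqP bE.
  (* The sign is absorbed into the coefficients [b i]. *)
  rewrite /in_colon /left_ideal_gen bE -sumrN; apply: lspan_sum => i iH.
  rewrite -mulNr; apply: (lspanZ (V := R^o)); apply: mem_lspan; by exists i.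
by rewrite -wE.
Qed.

(** * Last coordinates realized by combinations of associated syzygies *)

Variables (r : {set 'I_s.+1} -> nat) (d : forall H, 'I_(r H) -> R).
Hypothesis d_gen : forall H, basic_set tau l H ->
  forall x, in_colon X c tau H x <->
            left_ideal_gen (fun y => exists j, y = d (H := H) j) x.
Variable D : forall H, 'I_(r H) -> 'rV[ore_gr X]_s.+1.
Hypothesis D_assoc : forall H, basic_set tau l H ->
  forall j, assoc_syz c tau H (d (H := H) j) (D (H := H) j).
Local Notation BD := (fun v => exists2 H, basic_set tau l H &
  exists j, v = D (H := H) j).

(** With [H], [w] and b from [syz_in_colon], induction on how b is generated by the [d H j] lifts
    each combination in R to one in the graded ring with last coordinate alpha_w(b) t. *)
Lemma assoc_span_max_mon h t : (forall i, bijective (ore_alpha X i)) -> syz h ->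
  exists2 v, lspan BD v & v 0 ord_max = gr_mon X (gr_coef (h 0 ord_max) t) t.
Proof.
move=> X_aut /(syz_in_colon t X_aut)[H [w [b [Hb bcolon tE ->]]]].
have /and3P[sH _ _] := Hb.
have : left_ideal_gen (fun y => exists j : 'I_(r H), y = d (H := H) j) b by apply/d_gen.
move: b {bcolon}; apply: (lspan_min (V := R^o)) =>
  [|a b [v Bv vE] [v' Bv' vE']|a b [v Bv vE]|b].
- by exists 0; [exact: lspan0 | rewrite mxE alphaT_0 gr_mon0].
- exists (v + v'); first exact: lspanD.
  by rewrite mxE vE vE' alphaTD gr_monD.
(* A scalar [a] acting on b before the twist corresponds to alpha_w(a) acting after it. *)
- exists (gr_mon X (ore_alphaT X w a) 0%MM *: v); first exact: lspanZ.
  by rewrite mxE vE gr_monM alphaT0E add0m alphaTM.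
(* Multiplying by the term [w] applies alpha_w to the last coefficient and moves its term tau_H /
   tau_s to [t]. *)
case=> j ->; exists (gr_mon X 1 w *: D j).
  by apply/lspanZ/mem_lspan; exists H => //; exists j.
by rewrite mxE (assoc_syz_max sH (D_assoc Hb j)) gr_monM tE mul1r.
Qed.

Lemma assoc_span_max h : (forall i, bijective (ore_alpha X i)) -> syz h ->
  exists2 v, lspan BD v & v 0 ord_max = h 0 ord_max.
Proof.
move=> X_aut h0; rewrite (grE (h 0 ord_max)).
apply: (big_ind (fun f => exists2 v, lspan BD v & v 0 ord_max = f)).
- by exists 0; [exact: lspan0 | rewrite mxE].
- move=> _ _ [v Bv <-] [w Bw <-].
  by exists (v + w); [exact: lspanD | rewrite mxE].
by move=> t _; apply: assoc_span_max_mon.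
Qed.

End Step.

End GradedOre.

(* The step from the syzygies of the first s to those of the first s.+1 leading
   monomials, with 2 <= s.+1 <= u. *)
Theorem theorem48 (R E : nzRingType) (n m u s : nat)
    (R_domain : ring_domain R)
    (R_zacharias : left_zacharias R)
    (X : ore_ext R E n)
    (X_aut : forall i, bijective (ore_alpha X i))
    (le : rel 'X_{1..n}) (lem : rel ('X_{1..n} * 'I_m))
    (le_order : term_order le)
    (lem_order : module_term_order le lem)
    (g : 'I_u -> 'rV[E]_m)
    (g_neq0 : forall i, g i != 0)
    (c : 'I_u -> R) (tau : 'I_u -> 'X_{1..n}) (l : 'I_u -> 'I_m)
    (g_lead : forall i, is_lead_mon X lem (g i) (c i) (tau i) (l i))
    (s_ge2 : (2 <= s.+1)%N) (s_le : (s.+1 <= u)%N)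
    (c0 := c \o widen_ord (ltnW s_le))
    (tau0 := tau \o widen_ord (ltnW s_le))
    (l0 := l \o widen_ord (ltnW s_le))
    (c1 := c \o widen_ord s_le)
    (tau1 := tau \o widen_ord s_le)
    (l1 := l \o widen_ord s_le)
    (mu : nat) (A : 'I_mu -> 'rV[ore_gr X]_s)
    (A_homog : forall i, syz_homog tau0 l0 (A i))
    (A_gen : lgenerates (fun v => exists i, v = A i) (in_syz c0 tau0 l0))
    (r : {set 'I_s.+1} -> nat)
    (d : forall H : {set 'I_s.+1}, 'I_(r H) -> R)
    (d_gen : forall H, basic_set tau1 l1 H ->
      forall x, in_colon X c1 tau1 H x <->
                left_ideal_gen (fun y => exists j, y = d H j) x)
    (D : forall H : {set 'I_s.+1}, 'I_(r H) -> 'rV[ore_gr X]_s.+1)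
    (D_assoc : forall H, basic_set tau1 l1 H ->
      forall j, assoc_syz c1 tau1 H (d H j) (D H j))
    (B := fun v : 'rV[ore_gr X]_s.+1 =>
       (exists i, v = append0 (A i)) \/
       (exists2 H, basic_set tau1 l1 H & exists j, v = D H j)) :
  (forall v, B v -> syz_homog tau1 l1 v) /\ lgenerates B (in_syz c1 tau1 l1).
Proof.
have lastE (i : 'I_s) : widen_ord s_le (lift ord_max i) = widen_ord (ltnW s_le) i.
  by apply: val_inj; rewrite /= /bump leqNgt ltn_ord.
have cE : c0 =1 c1 \o lift ord_max by move=> i; rewrite /c0 /c1 /= lastE.
have tauE : tau0 =1 tau1 \o lift ord_max.
  by move=> i; rewrite /tau0 /tau1 /= lastE.
have lE : l0 =1 l1 \o lift ord_max by move=> i; rewrite /l0 /l1 /= lastE.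
split=> [v [[i ->]|[H Hb [j ->]]]|h].
- exact: syz_homog_append0 (A_homog i).
- exact: assoc_syz_homog (D_assoc H Hb j).
split=> [h0|]; last first.
  apply: in_syz_span => v [[i ->]|[H Hb [j ->]]].
    by apply/(in_syz_append0 _ cE tauE lE)/A_gen/mem_lspan; exists i.
  exact: assoc_syz_in_syz (D_assoc H Hb j).
have [v Bv vE] := assoc_span_max d_gen D_assoc X_aut h0.
have v0 : in_syz c1 tau1 l1 v.
  move: v Bv {vE}; apply: in_syz_span => v [H Hb [j ->]].
  exact: assoc_syz_in_syz (D_assoc H Hb j).
(* The last coordinates of [h] and [v] agree, so [h - v] is determined by its first [s] coordinates,
   which form a syzygy covered by [A_gen]. *)
set k : 'rV[ore_gr X]_s := \row_i (h - v) 0 (lift ord_max i).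
have kE : h - v = append0 k.
  apply/rowP => i; rewrite [RHS]mxE; case: unliftP => [j ->|->] /=.
    by rewrite [RHS]mxE.
  by rewrite !mxE vE subrr.
have sub_span (B' : 'rV[ore_gr X]_s.+1 -> Prop) w :
    (forall w, B' w -> B w) -> lspan B' w -> lspan B w.
  by move=> B'B [q [a [x [Bx ->]]]]; exists q, a, x; split=> // i; apply: B'B.
rewrite -(subrK v h) kE; apply: lspanD; last first.
  by apply: sub_span Bv => w; right.
have /A_gen/append0_span : in_syz c0 tau0 l0 k.
  apply/(in_syz_append0 _ cE tauE lE); rewrite -kE -[- v]scaleN1r.
  by apply: in_syzD h0 _; apply: in_syzZ.
by apply: sub_span => _ [_ [i ->] ->]; left; exists i.
Qed.
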